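(* Let $\mathbb{K}$ be a field. If $G$ is a gap-free and claw-free graph, then the $t$-path ideal $I_t(G) \subset \mathbb{K}[G]$ has linear quotients for $t \in \{3,4,5\}$. In particular, for these $t$ the ideal $I_t(G)$ has a linear resolution.
   Context: Graphs are finite and simple. A graph $G$ is gap-free if whenever $\{a,b\}$ and $\{c,d\}$ are disjoint edges of $G$, there is an edge of $G$ joining a vertex of $\{a,b\}$ to a vertex of $\{c,d\}$. $G$ is claw-free if it contains no induced subgraph isomorphic to $K_{1,3}$ (one center vertex joined to three leaves, with no other edges). $\mathbb{K}[G]$ is the polynomial ring over $\mathbb{K}$ in the variables $\{x_v : v \in V(G)\}$. The $t$-path ideal $I_t(G) \subset \mathbb{K}[G]$ is the ideal generated by the monomials $x_{v_1}\cdots x_{v_t}$ where $v_1,\dots,v_t$ are distinct vertices with $\{v_i,v_{i+1}\} \in E(G)$ for $1\le i\le t-1$ (paths on $t$ vertices, not necessarily induced). A monomial ideal $I$ with minimal monomial generating set $\operatorname{mingens}(I)$ has linear quotients if there is an order $u_1 < \cdots < u_m$ on $\operatorname{mingens}(I)$ such that for each $i = 2,\dots,m$ the colon ideal $\langle u_1,\dots,u_{i-1}\rangle : \langle u_i\rangle$ is generated by a subset of the variables. The zero ideal is considered to have linear quotients. A homogeneous ideal $I$ of a polynomial ring (standard grading) generated by its degree $t$ elements has a linear resolution if its graded Betti numbers satisfy $\beta_{i,j}(I) = 0$ for all $j \ne i + t$. The zero ideal is also said to have a linear resolution. *)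

(* Defs.v *)
From HB Require Import structures.
From mathcomp Require Import all_boot all_order all_algebra.
From mathcomp Require Import mpoly.

Set Implicit Arguments.
Unset Strict Implicit.
Unset Printing Implicit Defensive.

Import GRing.Theory.
Local Open Scope ring_scope.

Record sgraph := SGraph {
  vertex :> finType;
  edge : rel vertex;
  edge_sym : ssrbool.symmetric edge;
  edge_irrefl : irreflexive edge }.

Definition gap_free (G : sgraph) : Prop :=
  forall a b c d : G, edge a b -> edge c d ->
    [disjoint [set a; b] & [set c; d]] ->
    exists x y : G, [/\ x \in [set a; b], y \in [set c; d] & edge x y].

(* [None] is the center, the elements [Some i] are the leaves *)
Definition claw_edge : rel (option 'I_3) := fun x y => isSome x (+) isSome y.

Lemma claw_edge_sym : ssrbool.symmetric claw_edge.
Proof. by move=> x y; exact: addbC. Qed.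

Lemma claw_edge_irrefl : irreflexive claw_edge.
Proof. by move=> x; exact: addbb. Qed.

Definition claw : sgraph := SGraph claw_edge_sym claw_edge_irrefl.

Definition has_induced (H G : sgraph) : Prop :=
  exists f : H -> G,
    injective f /\ forall x y : H, edge (f x) (f y) = edge x y.

Definition claw_free (G : sgraph) : Prop := ~ has_induced claw G.

(* Ideals, as predicates considered up to pointwise equivalence *)

Section Ideals.
Variable R : comNzRingType.
Implicit Types (I J S : R -> Prop).

Definition ideal_gen S : R -> Prop := fun p =>
  exists (k : nat) (a g : 'I_k -> R),
    (forall i, S (g i)) /\ p = \sum_(i < k) a i * g i.

Definition ideal_eq I J : Prop := forall p, I p <-> J p.

Definition colon I J : R -> Prop := fun p => forall q, J q -> I (p * q).

End Ideals.

(* The variable x_v of K[G] is 'X_(enum_rank v). *)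
Definition path_gen (K : fieldType) (t : nat) (G : sgraph) :
    {mpoly K[#|G|]} -> Prop :=
  fun p => exists s : t.-tuple G,
    [/\ uniq s, sorted (@edge G) s & p = \prod_(v <- s) 'X_(enum_rank v)].

Definition path_ideal (K : fieldType) (t : nat) (G : sgraph) :
    {mpoly K[#|G|]} -> Prop :=
  ideal_gen (@path_gen K t G).

Section LinearQuotients.
Variables (K : fieldType) (n : nat).
Implicit Types (I : {mpoly K[n]} -> Prop) (s : seq 'X_{1..n}).

Definition monom_gen s : {mpoly K[n]} -> Prop :=
  ideal_gen (fun p => exists2 m, m \in s & p = 'X_[m]).

(* [s] enumerates, without repetition, an inclusion-minimal set of monomials
   generating [I]; for a monomial ideal there is exactly one such set. *)
Definition is_mingens I s : Prop :=
  [/\ uniq s,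
      ideal_eq I (monom_gen s)
    & forall s', {subset s' <= s} -> ideal_eq I (monom_gen s') ->
        {subset s <= s'}].

Definition has_linear_quotients I : Prop :=
  exists2 s, is_mingens I s &
    forall i, (0 < i < size s)%N ->
      exists A : {set 'I_n},
        ideal_eq (colon (monom_gen (take i s)) (monom_gen [:: nth 0%MM s i]))
                 (ideal_gen (fun p => exists2 x, x \in A & p = 'X_x)).

End LinearQuotients.

Section LinearResolution.
Variables (K : fieldType) (n : nat).
Local Notation S := {mpoly K[n]}.

(* A minimal graded free resolution
     ... -> F_2 -> F_1 -> F_0 -> I -> 0,  F_i = \bigoplus_k S(- mfr_deg i k),
   with F_i of rank [mfr_rank i]. Elements of F_i are row vectors, on which the
   matrices act on the right. The maps are homogeneous of degree 0, and
   minimality says that F_{i+1} maps into (x_1, ..., x_n) F_i. Shifts are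
   natural numbers since all generators and minimal syzygies of an ideal have
   nonnegative degree. *)
Record min_free_res (I : S -> Prop) := MinFreeRes {
  mfr_rank : nat -> nat;
  mfr_deg : forall i, 'I_(mfr_rank i) -> nat;
  mfr_diff : forall i, 'M[S]_(mfr_rank i.+1, mfr_rank i);
  mfr_aug : 'cV[S]_(mfr_rank 0);
  mfr_diff_homog : forall i k l m, m \in msupp (mfr_diff i k l) ->
    (mdeg m + mfr_deg l = mfr_deg k)%N;
  mfr_aug_homog : forall k m, m \in msupp (mfr_aug k 0) -> mdeg m = mfr_deg k;
  mfr_aug_surj : forall p,
    I p <-> exists v : 'rV[S]_(mfr_rank 0), (v *m mfr_aug) 0 0 = p;
  mfr_exact0 : forall v : 'rV[S]_(mfr_rank 0),
    v *m mfr_aug = 0 <-> exists w, w *m mfr_diff 0 = v;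
  mfr_exactS : forall i (v : 'rV[S]_(mfr_rank i.+1)),
    v *m mfr_diff i = 0 <-> exists w, w *m mfr_diff i.+1 = v;
  mfr_minimal : forall i k l, (mfr_diff i k l)@_0%MM = 0 }.

Definition betti (I : S -> Prop) (F : min_free_res I) (i j : nat) : nat :=
  #|[set k : 'I_(mfr_rank F i) | mfr_deg k == j]|.

(* A homogeneous ideal has a minimal graded free resolution, unique up to
   graded isomorphism, so its graded Betti numbers are those of any such
   resolution. *)
Definition has_linear_resolution (t : nat) (I : S -> Prop) : Prop :=
  ideal_eq I (ideal_gen (fun p => I p /\ p \is t.-homog)) /\
  exists F : min_free_res I, forall i j, j <> (i + t)%N -> betti F i j = 0%N.

End LinearResolution.

(* Main.v *)
(* Squarefree monomials of one degree have linear quotients in a given order as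
   soon as the corresponding sets satisfy: if B precedes A, then there are x in
   B \ A and y in A such that A - y + x precedes A.
   For t = 3, order the vertices so that each vertex is followed by its
   neighbours, and rank a path by its lexicographically first edge (c, d), with a
   tie-break on the third vertex. For two paths whose first edges are disjoint, a
   gap connects them, and the tie-break fails only if c has two earlier vertices
   that are adjacent to neither c nor d; they then form a claw with the vertex
   that put c in its place.
   From t to t + 1, rank a set by the first t-element path that it contains. In
   a claw-free graph a path on 3 or 4 vertices together with an adjacent vertex
   is again the vertex set of a path.
   Linear quotients give a linear resolution by iterated mapping cones: for a
   monomial u of degree d, (I + (u)) / I is S / (I : u) shifted by d, and I : u is
   generated by variables. Its own (Koszul) resolution is obtained in the same
   way, as variables have linear quotients. *)

Require Import Defs.
From mathcomp Require Import all_boot all_order all_algebra.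
From mathcomp Require Import mpoly.
From mathcomp Require Import zify.
From Stdlib Require Import ClassicalEpsilon.

Set Implicit Arguments.
Unset Strict Implicit.
Unset Printing Implicit Defensive.

Import GRing.Theory.

(** * Exchange orders *)

Section ExchangeOrders.
Variable T : finType.
Implicit Types (A B S : {set T}) (F : {set {set T}}) (s : seq {set T}).

Definition swap (x y : T) A := x |: (A :\ y).

(* Ties [r A = r B] are allowed only between sets that differ by one swap, so
   that they can be broken arbitrarily. *)
Definition exchange_order F (r : {set T} -> nat) := forall A B,
  A \in F -> B \in F -> A != B -> r B <= r A ->
  exists x y, [/\ x \in B :\: A, y \in A, swap x y A \in F
                & (r (swap x y A) < r A)%N \/ swap x y A = B].

(** Linear quotients in set form: the [k]-th set exceeds the [i]-th by [x] alone, so it puts the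
    variable of [x] into the colon ideal, and this variable divides what the [j]-th set
    contributes. *)
Definition exchange_seq s := forall i j, j < i -> i < size s ->
  exists x y k, [/\ x \in nth set0 s j :\: nth set0 s i, y \in nth set0 s i,
                    k < i & nth set0 s k = swap x y (nth set0 s i)].

Lemma exchange_order_seq F r : exchange_order F r ->
  exists s, [/\ uniq s, s =i F & exchange_seq s].
Proof.
move=> xF; pose leR A B := r A <= r B.
have trR : transitive leR by move=> A B C; apply: leq_trans.
have totR : total leR by move=> A B; apply: leq_total.
exists (sort leR (enum F)); set s := sort _ _.
have us : uniq s by rewrite sort_uniq enum_uniq.
have sF : s =i F by move=> A; rewrite mem_sort mem_enum.
have srt i j : i < j -> j < size s -> r (nth set0 s i) <= r (nth set0 s j).
  move=> ij js; apply: (sorted_ltn_nth trR set0 (sort_sorted totR _)) => //.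
  exact: ltn_trans js.
split=> // i j ji iS; have jS := ltn_trans ji iS.
have [| |||x [y [xB yA mF]]] := xF (nth set0 s i) (nth set0 s j).
- by rewrite -sF mem_nth.
- by rewrite -sF mem_nth.
- by rewrite nth_uniq // gtn_eqF.
- exact: srt.
set A := swap _ _ _ in mF *; have As : A \in s by rewrite sF.
case=> [ltA | eA]; exists x, y; last by exists j.
(* Ranks do not decrease along [s], so the strictly smaller rank of the swapped set forces an index
   below [i]. *)
exists (index A s); split=> //; last by rewrite nth_index.
rewrite ltnNge; apply/negP => iA; move: ltA; rewrite ltnNge => /negP; apply.
move: iA; rewrite leq_eqVlt => /predU1P[->|/srt]; first by rewrite nth_index.
by rewrite index_mem nth_index //; apply.
Qed.

(* The members of F' are ordered by the first member of F that they contain. *)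
Lemma exchange_order_lift F F' t s :
  uniq s -> s =i F -> exchange_seq s ->
  (forall A, A \in F -> #|A| = t) ->
  (forall S, S \in F' -> #|S| = t.+1 /\ exists2 A, A \in F & A \subset S) ->
  (forall A x y, A \in F -> swap x y A \in F -> x \notin A -> y \in A ->
     x |: A \in F') ->
  exists r, exchange_order F' r.
Proof.
move=> us sF xs cardF down up; pose r S := find (fun A => A \subset S) s.
have r_le k S : k < size s -> nth set0 s k \subset S -> r S <= k.
  by move=> ks kS; rewrite leqNgt; apply/negP => /(before_find set0); rewrite kS.
(* By cardinality, [S] has exactly one element more than its first member of [F]. *)
have rP S : S \in F' -> exists x, [/\ r S < size s, nth set0 s (r S) \in F,
    x \notin nth set0 s (r S) & S = x |: nth set0 s (r S)].
  move=> SF; have [cS [A AF AS]] := down _ SF.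
  have hS : has (fun A => A \subset S) s by apply/hasP; exists A; rewrite ?sF.
  have lt_r : r S < size s by rewrite -has_find.
  have sub := nth_find set0 hS; rewrite -/(r S) /= in sub.
  have rF : nth set0 s (r S) \in F by rewrite -sF mem_nth.
  have /cards1P[x Dx] : #|S :\: nth set0 s (r S)| == 1%N.
    by rewrite cardsD (setIidPr sub) cS cardF // subSnn.
  exists x; split=> //.
    by have := set11 x; rewrite -Dx inE => /andP[].
  by rewrite -Dx setUC setDE setUIr setUCr setIT; apply/esym/setUidPr.
exists r => S S' SF S'F neS le_r.
have [x [lt_i AF xA defS]] := rP _ SF; have [z [lt_j BF zB defS']] := rP _ S'F.
have swapS w : swap w x S = w |: nth set0 s (r S).
  by rewrite /swap {1}defS setU1K.
have xS : x \in S by rewrite defS setU11.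
have zS' : z \in S' by rewrite defS' setU11.
(* With a common first member, replacing [x] by [z] turns [S] into [S']. Otherwise an exchange in
   [F] yields [w] to put in place of [x], and the new set contains an earlier member of [F]. *)
move: le_r; rewrite leq_eqVlt => /predU1P[eq_r|lt_r].
  exists z, x; rewrite swapS -eq_r -defS'; split=> //; last by right.
  rewrite inE zS' andbT defS -eq_r !inE negb_or zB andbT.
  by apply: contra neS => /eqP zx; rewrite defS defS' eq_r zx.
have [w [y [k [wBA yA lt_k defk]]]] := xs _ _ lt_r lt_i.
have ks := ltn_trans lt_k lt_i.
move: wBA; rewrite inE => /andP[wA wB].
have sub_k : nth set0 s k \subset w |: nth set0 s (r S).
  by rewrite defk setUS // subD1set.
(* If [w] were in [S], it would be [x], and [S] would contain the [k]-th set, which precedes its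
   first member. *)
have wS : w \notin S.
  rewrite defS !inE negb_or wA andbT; apply/eqP => wx.
  by have := r_le k S ks; rewrite leqNgt lt_k defS -wx => /(_ sub_k).
exists w, x; rewrite swapS; split=> //; first by rewrite inE wS defS' inE wB orbT.
  by apply: (up _ w y) => //; rewrite -defk -sF mem_nth.
by left; apply: leq_ltn_trans lt_k; apply: r_le.
Qed.

End ExchangeOrders.


(** * Squarefree monomials and their colon ideals *)

Section SquarefreeMonomials.
Variable T : finType.
Local Notation n := #|T|.
Implicit Types (A B : {set T}) (s : seq {set T}).

Definition set_monom A : 'X_{1..n} := [multinom (enum_val i \in A : nat) | i < n].

Lemma set_monomE A x : set_monom A (enum_rank x) = (x \in A).
Proof. by rewrite mnmE enum_rankK. Qed.

Lemma set_monom_inj : injective set_monom.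
Proof.
move=> A B eqAB; apply/setP=> x.
by have /mnmP/(_ (enum_rank x)) := eqAB; rewrite !set_monomE; do 2!case: (x \in _).
Qed.

Lemma mdeg_set_monom A : mdeg (set_monom A) = #|A|.
Proof.
rewrite mdegE -sum1_card [RHS]big_mkcond /=.
rewrite (reindex_onto enum_rank enum_val) /= => [|i _]; last exact: enum_valK.
by apply: eq_big => [x|x _]; rewrite ?enum_rankK ?eqxx // set_monomE; case: (x \in A).
Qed.

(** Membership of a monomial in the colon is a divisibility test on exponents. The variables are
    those [x] by which alone some earlier set exceeds the [i]-th; the exchange finds one of them in
    every earlier set. *)
Lemma set_monom_colon s i : exchange_seq s -> i < size s ->
  exists A : {set 'I_n}, forall m,
    has (fun m' => m' <= m + nth 0%MM (map set_monom s) i)%MM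
        (take i (map set_monom s)) =
    has (fun m' => m' <= m)%MM [seq U_(x)%MM | x <- enum A].
Proof.
move=> xs lt_i; set Si := nth set0 s i.
exists [set x | [exists k : 'I_i, nth set0 s k :\: Si == [set enum_val x]]] => m.
rewrite (nth_map set0) // -/Si -map_take.
apply/hasP/hasP => [[m' /mapP[B]]|[m' /mapP[x]]].
  case/(nthP set0) => j; rewrite size_take lt_i => lt_j.
  rewrite nth_take // => <- -> {m'}.
  have [x [y [k [xB yS lt_k defk]]]] := xs _ _ lt_j lt_i.
  move=> /mnm_lepP/(_ (enum_rank x)); rewrite mnmDE !set_monomE.
  move: (xB); rewrite inE => /andP[xS ->]; rewrite (negbTE xS) addn0 => m_x.
  exists U_(enum_rank x)%MM; last first.
    by apply/mnm_lepP => l; rewrite mnm1E; case: eqP => // <-.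
  apply/map_f; rewrite mem_enum inE; apply/existsP; exists (Ordinal lt_k).
  rewrite /= defk enum_rankK; apply/eqP/setP=> z; rewrite !inE.
  by case: eqP => [->|_]; rewrite ?xS //= andbA andbC; case: (z \in Si); rewrite ?andbF.
rewrite mem_enum inE => /existsP[k /eqP defx] -> /mnm_lepP le_x.
have lt_k := ltn_trans (ltn_ord k) lt_i.
exists (set_monom (nth set0 s k)).
  apply/map_f; rewrite -(nth_take set0 (ltn_ord k)) mem_nth //.
  by rewrite size_take lt_i.
apply/mnm_lepP => l; rewrite mnmDE; move: (le_x l); rewrite !mnmE.
have := congr1 (fun A => enum_val l \in A) defx.
rewrite !inE (inj_eq enum_val_inj) eq_sym.
by case: (x == l) => [_|]; do 2!case: (_ \in _) => //=; rewrite ?addn1 //; lia.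
Qed.

End SquarefreeMonomials.

(** * Path sets of gap-free claw-free graphs *)

Section Graphs.
Variable G : sgraph.
Local Notation e := (@edge G).
Hypothesis gapG : gap_free G.
Hypothesis clawG : claw_free G.

Lemma edge_neq x y : e x y -> x != y.
Proof. by move=> xy; apply: contraTneq xy => ->; rewrite edge_irrefl. Qed.

Lemma claw_freeP x a b c : e x a -> e x b -> e x c ->
  a != b -> a != c -> b != c -> [|| e a b, e a c | e b c].
Proof.
move=> xa xb xc ab ac bc; apply/negPn/negP; rewrite !negb_or => /and3P[nab nac nbc].
apply: clawG; pose f (o : option 'I_3) :=
  if o is Some i then (if val i == 0 then a else if val i == 1 then b else c) else x.
have irr := @edge_irrefl G.
have neE : ((a == b) = false) * ((a == c) = false) * ((b == c) = false) *
    ((x == a) = false) * ((x == b) = false) * ((x == c) = false).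
  by rewrite (negbTE ab) (negbTE ac) (negbTE bc) !(negbTE (edge_neq _)).
exists f; split.
  move=> [[[|[|[|//]]] ?]|] [[[|[|[|//]]] ?]|] //= /eqP; rewrite /f /= ?neE //;
    rewrite 1?eq_sym ?neE // => _; by congr Some; apply: val_inj.
by move=> [[[|[|[|//]]] ?]|] [[[|[|[|//]]] ?]|] //=; rewrite /f /= ?irr //;
  rewrite ?(negbTE nab, negbTE nac, negbTE nbc) // edge_sym
     ?(negbTE nab, negbTE nac, negbTE nbc).
Qed.

Lemma gap_freeP a b c d : e a b -> e c d -> a != c -> a != d -> b != c -> b != d ->
  [|| e a c, e a d, e b c | e b d].
Proof.
move=> ab cd ac ad bc bd; have [] := gapG ab cd.
  rewrite -setI_eq0; apply/eqP/setP=> z; rewrite !inE.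
  apply/negP => /andP[/orP[]/eqP-> /orP[]/eqP eqz];
    by move: ac ad bc bd; rewrite eqz eqxx.
by move=> x [y []]; rewrite !inE => /orP[]/eqP-> /orP[]/eqP-> ->; rewrite ?orbT.
Qed.

(* The order is: a vertex [v], its neighbours, the other vertices recursively.
   If c is a neighbour of v, then v, c, x', y' form a claw; if c comes after the
   neighbours of v, so do all six vertices. *)
Lemma vertex_order : exists s : seq G, (forall x, x \in s) /\
  forall c d x y x' y', index c s < index d s -> index c s < index x s ->
    index c s < index y s -> index x' s < index c s -> index y' s < index c s ->
    x' != y' -> e c d -> e x x' -> e y y' ->
    ~~ e x' c -> ~~ e x' d -> ~~ e y' c -> e y' d.
Proof.
(* The statement is generalised to lists enumerating a subset, for induction. An absent vertex has
   index [size s], so [d], [x], [y] are required to be members; the others are, having smaller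
   indices. *)
suff [s [us mem_s sP]] : exists s : seq G, [/\ uniq s, s =i [set: G] &
  forall c d x y x' y', d \in s -> x \in s -> y \in s ->
    index c s < index d s -> index c s < index x s ->
    index c s < index y s -> index x' s < index c s -> index y' s < index c s ->
    x' != y' -> e c d -> e x x' -> e y y' ->
    ~~ e x' c -> ~~ e x' d -> ~~ e y' c -> e y' d].
  have all_s z : z \in s by rewrite mem_s inE.
  by exists s; split=> // c d x y x' y'; apply: sP.
have [m] := ubnP #|[set: G]|; elim: m [set: G] => // m IH U ltU.
have [->|[v vU]] := set_0Vmem U.
  by exists [::]; split=> // z; rewrite !inE.
pose N := [set z in U | e v z].
have [|s [us mem_s sP]] := IH (U :\: (v |: N)).
  rewrite ltnS in ltU; apply: leq_trans ltU; apply: proper_card; apply/properP.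
  by split; [exact: subsetDl | exists v; rewrite ?inE ?eqxx].
pose h := v :: enum N.
have memh z : (z \in h) = (z == v) || (z \in N) by rewrite inE mem_enum.
have vN : v \notin N by rewrite inE edge_irrefl andbF.
exists (h ++ s); split.
- rewrite cat_uniq us /= mem_enum vN enum_uniq /= andbT; apply/hasPn => z.
  by rewrite mem_s in_setD in_setU1 -memh => /andP[].
- move=> z; rewrite mem_cat memh mem_s !inE; case: eqP => [->|_] //=.
  by case: (z \in U); case: (e v z).
have idx_h z : z \in h -> index z (h ++ s) = index z h by rewrite index_cat => ->.
have idx_s z : z \notin h -> index z (h ++ s) = size h + index z s.
  by rewrite index_cat => /negbTE->.
have lt_h z : z \in h -> index z (h ++ s) < size h.
  by move=> zh; rewrite idx_h // index_mem.
have later c z : c \notin h -> index c (h ++ s) < index z (h ++ s) -> z \notin h.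
  move=> ch lt_c; apply/negP => /lt_h; rewrite ltnNge; apply/negP; rewrite negbK.
  by rewrite ltnW // (leq_ltn_trans _ lt_c) // idx_s // leq_addr.
move=> c d x y x' y' dS xS yS cd cx cy x'c y'c ne_xy ecd exx eyy nx'c nx'd ny'c.
apply/negPn/negP => ny'd.
have ne_idx u w : index u (h ++ s) < index w (h ++ s) -> u != w.
  by move=> lt_uw; apply: contraTneq lt_uw => ->; rewrite ltnn.
(* Otherwise the edges [x' y'] and [c d] would form a gap. *)
have nxy : ~~ e x' y'.
  apply/negP => exy; have := gap_freeP exy ecd.
  rewrite (negbTE nx'c) (negbTE nx'd) (negbTE ny'c) (negbTE ny'd).
  rewrite (ne_idx _ _ x'c) (ne_idx _ _ y'c).
  rewrite (ne_idx _ _ (ltn_trans x'c cd)) (ne_idx _ _ (ltn_trans y'c cd)).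
  by move=> /(_ isT isT isT isT).
have cS : c \in h ++ s by rewrite -index_mem (ltn_trans cd) // index_mem.
have [ch|ch] := boolP (c \in h).
  (* [c] is not [v], because [x'] precedes [c] and nothing precedes [v]. *)
  have vc : e v c.
    move: ch; rewrite memh => /predU1P[cv|]; last by rewrite inE => /andP[].
    by move: x'c; rewrite cv index_cat /= eqxx.
  have inN z : index z (h ++ s) < index c (h ++ s) -> ~~ e z c -> e v z.
    move=> zc nzc; have : z \in h.
      apply: contraLR zc => /idx_s->; rewrite -leqNgt.
      by rewrite (leq_trans (ltnW (lt_h _ ch))) ?leq_addr.
    rewrite memh => /predU1P[zv|]; first by rewrite zv vc in nzc.
    by rewrite inE => /andP[].
  have := claw_freeP vc (inN _ x'c nx'c) (inN _ y'c ny'c).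
  rewrite ![c == _]eq_sym (ne_idx _ _ x'c) (ne_idx _ _ y'c) ne_xy.
  move=> /(_ isT isT isT).
  by rewrite ![e c _]edge_sym (negbTE nx'c) (negbTE ny'c) (negbTE nxy).
have sub_s z : z \in h ++ s -> z \notin h -> (z \in s) && ~~ e v z.
  rewrite mem_cat => /orP[-> //|zs zh]; rewrite zs; move: zs zh.
  rewrite mem_s memh !inE negb_or.
  by case: (z \in U); rewrite ?andbF // => /= _ /andP[].
have dh := later _ _ ch cd; have xh := later _ _ ch cx; have yh := later _ _ ch cy.
have /andP[cs nvc] := sub_s _ cS ch; have /andP[ds nvd] := sub_s _ dS dh.
(* [z'] is not [v], as its neighbour [z] is not adjacent to [v]. It is not a neighbour of [v], since
   then [v z'] and [c d] would form a gap. *)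
have notin_h z z' : index z' (h ++ s) < index c (h ++ s) -> z \in h ++ s ->
    z \notin h -> e z z' -> ~~ e z' c -> ~~ e z' d -> z' \notin h.
  move=> z'c zS zh ezz' nz'c nz'd; rewrite memh negb_or; apply/andP; split.
    apply/eqP => z'v; have /andP[_] := sub_s _ zS zh.
    by rewrite edge_sym -z'v ezz'.
  rewrite inE; apply/negP => /andP[_ evz'].
  have vh w : w \notin h -> v != w by apply: contraNneq => <-; rewrite mem_head.
  have := gap_freeP evz' ecd; rewrite !vh // (ne_idx _ _ z'c).
  rewrite (ne_idx _ _ (ltn_trans z'c cd)).
  rewrite (negbTE nvc) (negbTE nvd) (negbTE nz'c) (negbTE nz'd).
  by move=> /(_ isT isT isT isT).
have x'h := notin_h _ _ x'c xS xh exx nx'c nx'd.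
have y'h := notin_h _ _ y'c yS yh eyy ny'c ny'd.
move/negP: ny'd; apply.
have /andP[xs _] := sub_s _ xS xh; have /andP[ys _] := sub_s _ yS yh.
by move: cd cx cy x'c y'c; rewrite !idx_s // !ltn_add2l => *; apply: (sP c d x y x').
Qed.

(** * Vertex sets of paths *)

Definition path_sets t : {set {set G}} :=
  [set [set x in val s] | s : t.-tuple G & uniq s && sorted e s].

Lemma path_setsP t S : reflect
  (exists s, [/\ uniq s, sorted e s, size s = t & S = [set x in s]])
  (S \in path_sets t).
Proof.
apply: (iffP imsetP) => [[s]|[s [us ps st ->]]].
  by rewrite inE => /andP[us ps] ->; exists s; rewrite size_tuple.
by exists (Tuple (introT eqP st)); rewrite // inE /= us.
Qed.

Lemma path_setsU1 t w s s' : uniq (w :: s) -> size s = t ->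
  size s' = t.+1 -> s' =i w :: s -> sorted e s' ->
  w |: [set x in s] \in path_sets t.+1.
Proof.
move=> us st st' ss' ps; apply/path_setsP; exists s'; split=> //.
  by rewrite (eq_uniq _ ss') //= st' st.
by apply/setP=> z; rewrite !inE ss' inE.
Qed.

Lemma card_path_sets t S : S \in path_sets t -> #|S| = t.
Proof. by move=> /path_setsP[s [us _ <- ->]]; rewrite cardsE; apply/card_uniqP. Qed.

Lemma path_sets_sub t S : S \in path_sets t.+1 ->
  exists2 A, A \in path_sets t & A \subset S.
Proof.
move=> /path_setsP[[|x s] [//= /andP[_ us] ps [st] ->]].
exists [set z in s].
  by apply/path_setsP; exists s; split=> //; apply: path_sorted ps.
by apply/subsetP => z; rewrite !inE => ->; rewrite orbT.
Qed.

Lemma path_sets_neighbour t S w : 1 < t -> S \in path_sets t -> w \in S ->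
  exists2 v, v \in S & e v w.
Proof.
move=> lt1t /path_setsP[s [us ps st ->]]; rewrite inE => ws.
move: lt1t us ps; rewrite -st; case/splitPr: ws => s1 s2; case: s2 => [|b s2].
  case/lastP: s1 => // s1 a _ _.
  rewrite -cats1 -catA => /cat_sorted2[_ /= /andP[aw _]].
  by exists a => //; rewrite inE mem_cat /= !inE eqxx orbT.
move=> _ _ /cat_sorted2[_ /= /andP[wb _]]; exists b; last by rewrite edge_sym.
by rewrite inE mem_cat !inE eqxx !orbT.
Qed.

(** If [w] is adjacent to an end of the path or to both inner vertices of a path on four, it is
    appended or inserted between them. Otherwise it hangs on one inner vertex, and claw-freeness
    joins the two path neighbours of that vertex. The path can then be rerouted so that the inner
    vertex comes next to an end, where [w] is attached. *)
Lemma path_sets_extend t A v w : 2 < t < 5 -> A \in path_sets t ->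
  v \in A -> w \notin A -> e v w -> w |: A \in path_sets t.+1.
Proof.
move=> t34 /path_setsP[s [us ps st ->]]; rewrite !inE => vs ws vw.
have us' : uniq (w :: s) by rewrite /= ws.
have intro s' := path_setsU1 (s' := s') us' st.
move: t s t34 st us ps vs ws vw us' intro.
move=> [|[|[|[|[|//]]]]] // [|a [|b [|c s]]] // _ [].
  case: s => // _ /=; rewrite !inE !negb_or !andbT.
  move=> /andP[/andP[ab ac] bc] /andP[eab ebc].
  move=> vs /and3P[wa wb wc] vw _ intro.
  have [wa'|nwa] := boolP (e w a).
    by apply: (intro [:: w; a; b; c]) => //=; rewrite wa' eab ebc.
  have [cw|ncw] := boolP (e c w).
    apply: (intro [:: a; b; c; w]) => //=; last by rewrite cw eab ebc.
    by move=> z; rewrite !inE; do 4!case: (z == _).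
  have bw : e b w.
    by move: vs vw nwa ncw; rewrite (edge_sym w) => /or3P[] /eqP-> ->.
  have ba : e b a by rewrite edge_sym.
  have := claw_freeP bw ba ebc wa wc ac.
  rewrite (negbTE nwa) (edge_sym w) (negbTE ncw) /= => eac.
  apply: (intro [:: w; b; a; c]) => //=; last by rewrite (edge_sym w) bw ba eac ?ecd.
  by move=> z; rewrite !inE; do 4!case: (z == _).
case: s => [|d [|//]] // _ /=; rewrite !inE !negb_or !andbT.
move=> /and3P[/and3P[ab ac ad] /andP[bc bd] cd] /and3P[eab ebc ecd].
move=> vs /and4P[wa wb wc wd] vw _ intro.
have ba : e b a by rewrite edge_sym.
have cb : e c b by rewrite edge_sym.
have [wa'|nwa] := boolP (e w a).
  by apply: (intro [:: w; a; b; c; d]) => //=; rewrite wa' eab ebc ecd.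
have [dw|ndw] := boolP (e d w).
  apply: (intro [:: a; b; c; d; w]) => //=; last by rewrite dw eab ebc ecd.
  by move=> z; rewrite !inE; do 5!case: (z == _).
have [bw|nbw] := boolP (e b w).
  have [cw|ncw] := boolP (e c w).
    apply: (intro [:: a; b; w; c; d]) => //=; last by rewrite eab bw (edge_sym w) cw ecd.
    by move=> z; rewrite !inE; do 5!case: (z == _).
  have := claw_freeP bw ba ebc wa wc ac.
  rewrite (negbTE nwa) (edge_sym w) (negbTE ncw) /= => eac.
  apply: (intro [:: w; b; a; c; d]) => //=; last by rewrite (edge_sym w) bw ba eac ?ecd.
  by move=> z; rewrite !inE; do 5!case: (z == _).
have cw : e c w.
  by move: vs vw nwa nbw ndw; rewrite (edge_sym w) => /or4P[] /eqP-> ->.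
have := claw_freeP cw cb ecd wb wd bd.
rewrite (edge_sym w) (negbTE nbw) (edge_sym w) (negbTE ndw) /= => ebd.
apply: (intro [:: a; b; d; c; w]) => //=; last by rewrite eab ebd (edge_sym d) ecd cw.
by move=> z; rewrite !inE; do 5!case: (z == _).
Qed.

(** * Paths on three vertices *)

Lemma path_set3 x y z : e x y -> e y z -> x != z -> [set x; y; z] \in path_sets 3.
Proof.
move=> xy yz xz; apply/path_setsP; exists [:: x; y; z].
split=> //=; rewrite ?xy ?yz // ?inE ?negb_or ?(edge_neq xy) ?(edge_neq yz) ?xz //.
by apply/setP=> v; rewrite !inE orbA.
Qed.

(** Any edge inside [S] can play the first two vertices: the remaining vertex has a neighbour in
    [S], which is [c] or [d]. *)
Lemma path_set3_edge S c d : S \in path_sets 3 -> c \in S -> d \in S -> e c d ->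
  exists b, [/\ b != c, b != d, S = [set c; d; b] & e c b || e d b].
Proof.
move=> S3 cS dS cd; have cS3 := card_path_sets S3.
have ncd := edge_neq cd.
have /cards1P[b Db] : #|S :\ c :\ d| == 1.
  by move: cS3; rewrite (cardsD1 c) cS (cardsD1 d) !inE eq_sym ncd dS !add1n => -[->].
have := set11 b; rewrite -Db !inE => /and3P[bd bc bS].
have defS : S = [set c; d; b].
  apply/setP=> z; have /setP/(_ z) := Db; rewrite !inE.
  by case: eqP => [->|_]; case: eqP => [->|_]; rewrite ?cS ?dS ?orbT.
exists b; split=> //; have [v vS vb] := path_sets_neighbour (isT : 1 < 3) S3 bS.
move: vS vb; rewrite defS !inE -orbA.
by case/or3P=> /eqP->; rewrite ?edge_irrefl // => ->; rewrite ?orbT.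
Qed.

Lemma swap_last (b c d w : G) : b != c -> b != d ->
  swap w b [set c; d; b] = [set c; d; w].
Proof.
move=> bc bd; apply/setP=> z; rewrite !inE.
have [->|_] := eqVneq z b; first by rewrite (negbTE bc) (negbTE bd) /= orbF.
by rewrite orbF orbC.
Qed.

(** A neighbour [v] of [x] in [S] is kept along with [x], and [w] replaces the third vertex: [v],
    [x], [w] is a path. *)
Lemma path_set3_swap S x w : S \in path_sets 3 -> x \in S -> w \notin S -> e x w ->
  exists y, [/\ y \in S, y != x & swap w y S \in path_sets 3].
Proof.
move=> S3 xS wS xw; have [v vS vx] := path_sets_neighbour (isT : 1 < 3) S3 xS.
have [b [bv bx defS _]] := path_set3_edge S3 vS xS vx.
exists b; split=> //; first by rewrite defS !inE eqxx orbT.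
rewrite defS swap_last // path_set3 //.
by apply: contraNneq wS => <-.
Qed.

Lemma path_set3_exchange_order : exists r, exchange_order (path_sets 3) r.
Proof.
have [s [mem_s sP]] := vertex_order.
pose rho x := index x s; pose N := (size s).+1.
have rho_lt x : rho x < N by rewrite ltnS ltnW // index_mem.
have rho_inj x y : rho x = rho y -> x = y.
  by move=> eq_xy; rewrite -(nth_index x (mem_s x)) -/(rho x) eq_xy nth_index.
(* Positions are digits in base [N], so [kappa] compares ordered pairs lexicographically. *)
pose kappa (u : G * G) := rho u.1 * N + rho u.2.
have kappa_div u : kappa u %/ N = rho u.1 by rewrite divnMDl // divn_small ?addn0.
have kappa_mod u : kappa u %% N = rho u.2 by rewrite modnMDl modn_small.
have kappa_inj : injective kappa.
  move=> [a b] [c d] eq_k; congr pair; apply: rho_inj.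
    by rewrite -[LHS](kappa_div (a, b)) eq_k kappa_div.
  by rewrite -[LHS](kappa_mod (a, b)) eq_k kappa_mod.
have kappa_le a b c d : kappa (a, b) <= kappa (c, d) -> rho a <= rho c.
  by move=> /(leq_div2r N); rewrite !kappa_div.
have lt_kappa a b c d : rho a < rho c -> kappa (a, b) < kappa (c, d).
  by rewrite !ltnNge; apply: contra; apply: kappa_le.
(* All edges inside [S] count, in both orientations, since a set need not determine its path. *)
pose inS (S : {set G}) (u : G * G) := [&& u.1 \in S, u.2 \in S & e u.1 u.2].
pose first S u := inS S u && [forall v, inS S v ==> (kappa u <= kappa v)].
have firstP S : S \in path_sets 3 -> exists u, first S u.
  case/path_setsP=> [[|a [|b l]] [_ //= /andP[ab _] _ defS]].
  have iab : inS S (a, b) by rewrite /inS defS !inE !eqxx /= orbT.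
  exists [arg min_(v < (a, b) | inS S v) kappa v]; case: arg_minnP => // u iu min_u.
  by rewrite /first iu; apply/forallP => v; apply/implyP; apply: min_u.
pose Q c d x := [exists x', [&& e x x', rho x' < rho c, ~~ e x' c & ~~ e x' d]].
(* Paths with first edge [u] come earlier if their third vertex satisfies [Q]. *)
pose del u (S : {set G}) := ~~ [exists x in S :\ u.1 :\ u.2, Q u.1 u.2 x].
(* Doubling lets the first edge dominate the tie-break [del]. The value 0 is for sets without an
   edge and is never met on [path_sets 3]. *)
pose r (S : {set G}) :=
  if [pick u | first S u] is Some u then (kappa u).*2 + del u S else 0.
have rE S u : first S u -> r S = (kappa u).*2 + del u S.
  move=> fu; rewrite /r; case: pickP => [v|/(_ u)]; last by rewrite fu.
  move: fu => /andP[iu /forallP mu] /andP[iv /forallP mv].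
  suff -> : v = u by [].
  by apply/kappa_inj/eqP; rewrite eqn_leq (implyP (mv _)) // (implyP (mu _)).
have r_lt S S' u a b : first S u -> S' \in path_sets 3 -> inS S' (a, b) ->
    kappa (a, b) < kappa u -> r S' < r S.
  move=> fu /firstP[v fv] iab lt_k; rewrite (rE _ _ fu) (rE _ _ fv).
  have /andP[_ /forallP/(_ (a, b))] := fv; rewrite iab /= => le_v.
  by move: (del u S) (del v S'); lia.
exists r => S T S3 T3 neST le_r.
have [[c d] fS] := firstP _ S3; have [[p q] fT] := firstP _ T3.
rewrite (rE _ _ fS) (rE _ _ fT) in le_r.
have {le_r} le_k : kappa (p, q) <= kappa (c, d).
  by move: le_r; do 2!case: (del _ _); lia.
have [/and3P[/= cS dS cd] /forallP minS'] := andP fS.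
have minS x y : x \in S -> y \in S -> e x y -> kappa (c, d) <= kappa (x, y).
  by move=> xS yS xy; apply: (implyP (minS' (x, y))); rewrite /inS /= xS yS.
have [/and3P[/= pT qT pq] _] := andP fT.
have cSd : rho c < rho d.
  rewrite ltn_neqAle (kappa_le c d d c) ?minS // 1?edge_sym // andbT.
  by apply/eqP => /rho_inj eq_cd; rewrite eq_cd edge_irrefl in cd.
have [b [bc bd defS cdb]] := path_set3_edge S3 cS dS cd.
have bS : b \in S by rewrite defS !inE eqxx orbT.
move: le_k; rewrite leq_eqVlt => /predU1P[/kappa_inj[eq_p eq_q]|lt_k].
  subst p q; have [x [xc xd defT _]] := path_set3_edge T3 pT qT pq.
  have swE : swap x b S = T by rewrite defS defT swap_last.
  exists x, b; rewrite swE; split=> //; last by right.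
  rewrite !inE defT defS !inE eqxx !orbT andbT !negb_or xc xd /=.
  by apply: contra neST => /eqP xb; rewrite defS defT xb.
(* Swapping in [w] while keeping [x] brings an edge earlier than [(c, d)] into the set, so the rank
   drops. *)
have hop x w : x \in S -> w \in T -> w \notin S -> e x w ->
    (kappa (x, w) < kappa (c, d)) || (kappa (w, x) < kappa (c, d)) ->
    exists x y, [/\ x \in T :\: S, y \in S, swap x y S \in path_sets 3
                & r (swap x y S) < r S \/ swap x y S = T].
  move=> xS wT wS xw lt_xw; have [y [yS yx sw3]] := path_set3_swap S3 xS wS xw.
  exists w, y; split=> //; first by rewrite inE wS.
  have xsw : x \in swap w y S by rewrite !inE xS [x == y]eq_sym yx orbT.
  have wsw : w \in swap w y S by rewrite !inE eqxx.
  left; case/orP: lt_xw; apply: r_lt => //; rewrite /inS /= ?xsw ?wsw //.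
  by rewrite edge_sym.
have [pS|pS] := boolP (p \in S); have [qS|qS] := boolP (q \in S).
- by have := minS _ _ pS qS pq; rewrite leqNgt lt_k.
- by apply: (hop p q); rewrite ?lt_k.
- by apply: (hop q p); rewrite ?lt_k ?orbT // edge_sym.
(* From here on, [p] and [q] are outside [S]. An edge from [S] to one of them that precedes [(c, d)]
   is settled by [hop]; the remaining case has none. *)
have [/exists_inP[x xS /exists_inP[w wpq /andP[xw lt_xw]]]|none] :=
    boolP [exists x in S, exists w in [set p; q], e x w &&
      ((kappa (x, w) < kappa (c, d)) || (kappa (w, x) < kappa (c, d)))].
  by apply: (hop x w) => //; case/set2P: wpq => ->.
have {}none x w : x \in S -> w \in [set p; q] -> e x w ->
    (kappa (c, d) <= kappa (x, w)) && (kappa (c, d) <= kappa (w, x)).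
  move=> xS wpq xw; apply: contraR none; rewrite negb_and -!ltnNge => lt_xw.
  by apply/exists_inP; exists x => //; apply/exists_inP; exists w; rewrite // xw.
have rho_none x w : x \in S -> w \in [set p; q] -> e x w -> rho c <= rho w.
  by move=> xS wpq xw; have /andP[_ /kappa_le] := none x w xS wpq xw.
have lt_rho x y : x \in S -> y \notin S -> rho x <= rho y -> rho x < rho y.
  move=> xS yS; rewrite leq_eqVlt => /predU1P[/rho_inj eq_xy|//].
  by rewrite -eq_xy xS in yS.
have pc : rho p < rho c.
  have := kappa_le _ _ _ _ (ltnW lt_k); rewrite leq_eqVlt => /predU1P[/rho_inj eq_pc|//].
  by rewrite eq_pc cS in pS.
have pS' x : x \in S -> ~~ e x p.
  move=> xS; apply/negP => /rho_none; rewrite xS !inE eqxx => /(_ isT isT).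
  by rewrite leqNgt pc.
(* [p] is adjacent to nothing in [S], so the edge that joins [p q] to [c d] by gap-freeness starts
   at [q]. *)
have qcd : e c q || e d q.
  have neS u v : u \notin S -> v \in S -> u != v.
    by move=> uS vS; apply: contraNneq uS => ->.
  have := gap_freeP pq cd.
  rewrite !neS // => /(_ isT isT isT isT).
  by rewrite ![e _ c]edge_sym ![e _ d]edge_sym (negbTE (pS' _ cS)) (negbTE (pS' _ dS)).
have cq : rho c < rho q.
  apply: lt_rho => //; case/orP: qcd; [apply: rho_none cS _ | apply: rho_none dS _];
  by rewrite !inE eqxx orbT.
have cb : rho c < rho b.
  rewrite ltn_neqAle; apply/andP; split.
    by apply/eqP => /rho_inj cb; rewrite cb eqxx in bc.
  by case/orP: cdb => xb; [apply: (kappa_le c d b c) | apply: (kappa_le c d b d)];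
    apply: minS; rewrite // edge_sym.
have Qq : Q c d q.
  by apply/existsP; exists p; rewrite edge_sym pq pc ![e p _]edge_sym !pS'.
(* Otherwise [b'] and [p] would be two vertices before [c] as in [vertex_order], which would make
   [p] adjacent to [d]. *)
have nQb : ~~ Q c d b.
  apply/existsP => -[b' /and4P[bb' b'c nb'c nb'd]].
  have ne_b'p : b' != p by apply: contraTneq bb' => ->; apply: pS'.
  have npc : ~~ e p c by rewrite edge_sym pS'.
  have qp : e q p by rewrite edge_sym.
  have := sP c d b q b' p cSd cb cq b'c pc ne_b'p cd bb' qp nb'c nb'd npc.
  by rewrite edge_sym (negbTE (pS' _ dS)).
have swE : swap q b S = [set c; d; q] by rewrite defS swap_last.
have ncd : c != d by apply: edge_neq.
have qc : q != c by apply: contraNneq qS => ->.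
have qd : q != d by apply: contraNneq qS => ->.
exists q, b; rewrite swE; split=> //; first by rewrite inE qS.
  case/orP: qcd => [cq'|dq']; last by rewrite path_set3 // eq_sym.
  have -> : [set c; d; q] = [set d; c; q] by rewrite [[set c; d]]setUC.
  have dc : e d c by rewrite edge_sym.
  by rewrite (path_set3 dc cq') // eq_sym.
(* Replacing [b] by [q] keeps the first edge [(c, d)], because no edge at [q] precedes it, while
   [del] drops from 1 to 0. *)
left; have fS' : first [set c; d; q] (c, d).
  apply/andP; split; first by rewrite /inS /= !inE !eqxx orbT.
  apply/forallP => -[x y]; apply/implyP => /and3P[/= xS' yS' xy].
  have inS_or z : z \in [set c; d; q] -> z \in S \/ z = q.
    by rewrite !inE => /orP[/orP[]/eqP->|/eqP->]; auto.
  have [xS|->] := inS_or x xS'; last exact/ltnW/lt_kappa.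
  have [yS|eq_y] := inS_or y yS'; first exact: minS.
  by rewrite eq_y in xy *; have /andP[] := none x q xS (set22 p q) xy.
rewrite (rE _ _ fS) (rE _ _ fS').
have -> : del (c, d) S.
  apply/exists_inP => -[x]; rewrite defS !inE /= => /and3P[xd xc].
  by rewrite (negbTE xd) (negbTE xc) /= => /eqP->; apply/negP.
have /negbTE-> : ~~ del (c, d) [set c; d; q].
  by rewrite negbK; apply/exists_inP; exists q; rewrite // !inE /= qc qd eqxx !orbT.
by rewrite addn0 addn1.
Qed.

(** * Paths on four and five vertices *)

Lemma path_sets_exchange_lift t r : 2 < t < 5 ->
  exchange_order (path_sets t) r ->
  exists r', exchange_order (path_sets t.+1) r'.
Proof.
move=> t34 /exchange_order_seq[s [us sF xs]].
apply: exchange_order_lift us sF xs _ _ _ => [A|S SF|A x y AF swF xA yA].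
- exact: card_path_sets.
- by split; [exact: card_path_sets | exact: path_sets_sub].
(* As [swap x y A] is a path set, [x] has a neighbour in it, which lies in [A]; hence [x] extends
   the path on [A]. *)
have [|v] := path_sets_neighbour _ swF (setU11 x _).
  by case/andP: t34 => /ltnW.
rewrite !inE => /orP[/eqP->|/andP[_ vA] vx]; first by rewrite edge_irrefl.
exact: path_sets_extend vx.
Qed.

Lemma path_sets_exchange_order t : t \in [:: 3; 4; 5] ->
  exists r, exchange_order (path_sets t) r.
Proof.
have [r3 x3] := path_set3_exchange_order.
have [r4 x4] := path_sets_exchange_lift (isT : 2 < 3 < 5) x3.
have x5 := path_sets_exchange_lift (isT : 2 < 4 < 5) x4.
by rewrite !inE => /or3P[]/eqP-> //; [exists r3 | exists r4].
Qed.

End Graphs.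

(** * Linear resolutions *)

(** Serves to build a chain map degree by degree: the matrix sizes vary with [i], and each lift is
    only known to exist once the previous one is chosen. [P] carries what the next choice needs. *)
Lemma dependent_choice_nat (T : nat -> Type) (P : forall i, T i -> Prop)
    (R : forall i, T i -> T i.+1 -> Prop) (x0 : T 0) :
  P 0 x0 ->
  (forall i x, P i x -> exists2 y, P i.+1 y & R i x y) ->
  exists f : forall i, T i,
    f 0 = x0 /\ forall i, P i (f i) /\ R i (f i) (f i.+1).
Proof.
move=> Px0 step.
have next i (x : {x | P i x}) : {y : {y | P i.+1 y} | R i (sval x) (sval y)}.
  apply: constructive_indefinite_description.
  by have [y Py Rxy] := step i _ (proj2_sig x); exists (exist _ y Py).
pose f := fix f i : {x | P i x} :=
  if i is i'.+1 then sval (next i' (f i')) else exist _ x0 Px0.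
exists (fun i => sval (f i)); split=> // i.
by split; [exact: (proj2_sig (f i)) | exact: (proj2_sig (next i (f i)))].
Qed.

(** * Homogeneous matrices over the polynomial ring *)

Section HomogeneousMatrices.
Local Open Scope ring_scope.
Variables (K : fieldType) (n : nat).
Local Notation S := {mpoly K[n]}.

Definition mx_homog d p q (A : 'M[S]_(p, q)) := forall i j, A i j \is d.-homog.

Lemma mx_homogM d e p q r (A : 'M[S]_(p, q)) (B : 'M[S]_(q, r)) :
  mx_homog d A -> mx_homog e B -> mx_homog (d + e) (A *m B).
Proof.
by move=> hA hB i j; rewrite mxE; apply: rpred_sum => k _; apply: dhomogM.
Qed.

Lemma mx_homogN d p q (A : 'M[S]_(p, q)) : mx_homog d A -> mx_homog d (- A).
Proof. by move=> hA i j; rewrite mxE rpredN. Qed.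

Lemma mx_homog0 d p q : mx_homog d (0 : 'M[S]_(p, q)).
Proof. by move=> i j; rewrite mxE rpred0. Qed.

Lemma mx_homog_block d p q r s (A : 'M[S]_(p, q)) (B : 'M[S]_(p, r))
    (C : 'M[S]_(s, q)) (D : 'M[S]_(s, r)) :
  mx_homog d A -> mx_homog d B -> mx_homog d C -> mx_homog d D ->
  mx_homog d (block_mx A B C D).
Proof.
move=> hA hB hC hD i j.
have [i' ->|i' ->] := split_ordP i; have [j' ->|j' ->] := split_ordP j.
- by rewrite block_mxEul.
- by rewrite block_mxEur.
- by rewrite block_mxEdl.
- by rewrite block_mxEdr.
Qed.

Lemma pihomogM_homog d e (p q : S) : q \is e.-homog ->
  pihomog mdeg (d + e) (p * q) = pihomog mdeg d p * q.
Proof.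
move=> hq; rewrite {1}(mpolyE p) [in RHS](mpolyE p).
rewrite mulr_suml !raddf_sum /= mulr_suml; apply: eq_bigr => m _.
rewrite -scalerAl !linearZ /= -scalerAl; congr (_ *: _).
have hXq : 'X_[m] * q \is (mdeg m + e).-homog.
  by apply: dhomogM => //; rewrite dhomogX.
rewrite pihomogX; case: eqP => [<- | /eqP ne]; first by rewrite pihomog_dE.
by rewrite mul0r; apply: pihomog_ne0 hXq; rewrite eqn_add2r.
Qed.

(** Rows are lifted separately. Taking the degree [a] part of every entry of the lift preserves the
    equation, because [B] and [A] are homogeneous of degrees [b] and [a + b]. *)
Lemma homog_lift a b p q r (A : 'M[S]_(p, r)) (B : 'M[S]_(q, r)) :
  mx_homog b B -> mx_homog (a + b) A ->
  (forall v : 'rV[S]_p, exists w, w *m B = v *m A) ->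
  exists2 C, mx_homog a C & C *m B = A.
Proof.
move=> hB hA lift.
have {lift} [W hW] : exists W : 'M[S]_(p, q), W *m B = A.
  have [w hw] := fin_all_exists (fun i => lift (row i 1%:M)).
  exists (\matrix_i w i); apply/row_matrixP => i.
  by rewrite row_mul rowK hw -row_mul mul1mx.
exists (map_mx (pihomog mdeg a) W) => [i j|]; first by rewrite mxE pihomogP.
apply/matrixP=> i j; rewrite -[RHS](pihomog_dE (hA i j)) -hW !mxE raddf_sum /=.
by apply: eq_bigr => k _; rewrite mxE (pihomogM_homog _ _ (hB k j)).
Qed.

End HomogeneousMatrices.

(** * Linear resolutions and mapping cones *)

Section LinearResolutions.
Local Open Scope ring_scope.
Variables (K : fieldType) (n : nat).
Local Notation S := {mpoly K[n]}.
Implicit Types I J : S -> Prop.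

(** The shifts stay implicit: all generators of the [i]-th module have degree [i + d], so
    homogeneity says that the differentials have linear entries. *)
Definition lin_res d I := exists (r : nat -> nat)
    (D : forall i, 'M[S]_(r i.+1, r i)) (a : 'cV[S]_(r 0)),
  [/\ forall i, mx_homog 1 (D i), mx_homog d a,
      forall p, I p <-> exists v : 'rV[S]_(r 0), v *m a = p%:M,
      forall v : 'rV[S]_(r 0), v *m a = 0 <-> exists w, w *m D 0 = v
    & forall i (v : 'rV[S]_(r i.+1)), v *m D i = 0 <-> exists w, w *m D i.+1 = v].

Lemma lin_res_ext d I J : ideal_eq I J -> lin_res d I -> lin_res d J.
Proof.
move=> eqIJ [r [D [a [h1 h2 h3 h4 h5]]]]; exists r, D, a; split=> // p.
by rewrite -eqIJ.
Qed.

Lemma lin_res0 d : lin_res d (fun p => p = 0).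
Proof.
exists (fun=> 0), (fun=> 0), 0; split.
- by move=> i; exact: mx_homog0.
- exact: mx_homog0.
- move=> p; split=> [->|[v]]; first by exists 0; rewrite mulmx0 raddf0.
  by rewrite mulmx0 => /(congr1 (fun A : 'M[S]_1 => A 0 0)); rewrite !mxE eqxx.
- move=> v; split=> _; last by rewrite mulmx0.
  by exists 0; rewrite mulmx0; apply/rowP; case.
- move=> i v; split=> _; last by rewrite mulmx0.
  by exists 0; rewrite mulmx0; apply/rowP; case.
Qed.

(* The mapping cone of a lift of multiplication by [u] from the resolution
   [S <- G_0 <- ...] of S / (I : u), with J = I : u, to that of S / I. *)
Lemma lin_res_cone d I J I' u : lin_res d I -> lin_res 1 J -> u \is d.-homog ->
  (forall g, J g <-> I (g * u)) ->
  (forall p, I' p <-> exists f g, I f /\ p = f + g * u) ->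
  lin_res d I'.
Proof.
move=> [rF [F [a [homF homa Fsurj Fex0 FexS]]]].
move=> [rG [D [b [homD homb Gsurj Gex0 GexS]]]] homu defJ defI'.
(* [G] resolves S / J: the resolution of J is moved up by one, below it stands a free module of rank
   1. *)
pose gr i := if i is i'.+1 then rG i' else 1%N.
pose G i : 'M[S]_(gr i.+1, gr i) := if i is i'.+1 then D i' else b.
have homG i : mx_homog 1 (G i) by case: i.
have Gex i (v : 'rV[S]_(gr i.+1)) : v *m G i = 0 <-> exists w, w *m G i.+1 = v.
  by case: i v.
have uE (v : 'rV[S]_1) : v *m u%:M = (v 0 0 * u)%:M.
  by rewrite {1}[v]mx11_scalar -scalar_mxM.
(* The image of [b] is J, and [u] times J lies in I, which is the image of [a]. *)
have surjI (v : 'rV[S]_(rG 0)) : exists w, w *m a = v *m (- (b *m u%:M)).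
  have /Fsurj [w hw] : I (- ((v *m b) 0 0) * u).
    apply/defJ/Gsurj; exists (- v).
    by rewrite mulNmx [in LHS](mx11_scalar (v *m b)) raddfN.
  by exists w; rewrite hw mulNr raddfN mulmxN mulmxA uE.
have GG i : G i.+1 *m G i = 0.
  apply/row_matrixP => j; rewrite row_mul row0.
  by apply/Gex; exists (row j 1%:M); rewrite -row_mul mul1mx.
have Gb : G 1%N *m b = 0 := GG 0%N.
have [psi0 homp0 hpsi0] : exists2 C : 'M[S]_(gr 1, rF 0),
    mx_homog 1 C & C *m a = - (b *m u%:M).
  apply: homog_lift homa _ surjI; apply: mx_homogN; apply: mx_homogM => //.
  by move=> i j; rewrite !ord1 mxE eqxx.
pose T i := 'M[S]_(gr i.+1, rF i).
(* The invariant of the choice: the lifting problem for the next map is solvable. *)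
pose lifts i (x : T i) :=
  forall v : 'rV[S]__, exists w, w *m F i = v *m - (G i.+1 *m x).
have [psi [psi0E psiP]] : exists psi : forall i, T i, psi 0%N = psi0 /\
    forall i, (mx_homog 1 (psi i) /\ lifts i (psi i))
              /\ psi i.+1 *m F i = - (G i.+1 *m psi i).
  apply: (dependent_choice_nat (P := fun i x => mx_homog 1 x /\ lifts i x)
    (R := fun i x y => y *m F i = - (G i.+1 *m x))).
    split=> // v; apply/Fex0.
    rewrite -mulmxA mulNmx -mulmxA hpsi0 !mulmxN (mulmxA (G 1%N) b) Gb.
    by rewrite mul0mx !(oppr0, mulmx0).
  move=> i x [homx liftx].
  have [y homy yE] := homog_lift (homF i) (mx_homogN (mx_homogM (homG _) homx)) liftx.
  exists y => //; split=> // v; apply/FexS.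
  rewrite -mulmxA mulNmx -mulmxA yE !mulmxN (mulmxA (G _) (G _)) GG.
  by rewrite mul0mx !(oppr0, mulmx0).
have {}hpsi0 : psi 0%N *m a = - (b *m u%:M) by rewrite psi0E.
have homp i : mx_homog 1 (psi i) by case: (psiP i) => [[]].
have hpsi i : psi i.+1 *m F i = - (G i.+1 *m psi i) by case: (psiP i).
(* The signs chosen for [psi] make consecutive block matrices compose to zero, and its degree 1
   keeps the cone linear. *)
exists (fun i => rF i + gr i)%N, (fun i => block_mx (F i) 0 (psi i) (G i)),
  (col_mx a u%:M); split.
- by move=> i; apply: mx_homog_block => //; apply: mx_homog0.
- move=> i j; rewrite ord1; have [k ->|k ->] := split_ordP i.
    by rewrite col_mxEu.
  by rewrite col_mxEd ord1 mxE eqxx.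
- move=> p; rewrite defI'; split=> [[f [g [/Fsurj [w hw] ->]]]|[v]].
    by exists (row_mx w g%:M); rewrite mul_row_col hw -scalar_mxM -raddfD.
  rewrite -[v]hsubmxK mul_row_col uE => hv.
  exists ((lsubmx v *m a) 0 0), (rsubmx v 0 0); split.
    by apply/Fsurj; exists (lsubmx v); rewrite -mx11_scalar.
  by have /(congr1 (fun A : 'M[S]_1 => A 0 0)) := hv; rewrite !mxE eqxx.
- move=> v; split=> [|[w <-]]; last first.
    have Fa : F 0 *m a = 0.
      apply/row_matrixP => j; rewrite row_mul row0.
      by apply/Fex0; exists (row j 1%:M); rewrite -row_mul mul1mx.
    by rewrite -mulmxA mul_block_col mul0mx addr0 hpsi0 addNr Fa col_mx0 mulmx0.
  rewrite -{1}[v]hsubmxK mul_row_col => hv.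
  (* From f a + g u = 0 it follows that g is in J, so g = w b. Subtracting w [psi 0] from f leaves a
     cycle of the resolution of I. *)
  have /Gsurj [w hw] : J (rsubmx v 0 0).
    apply/defJ/Fsurj; exists (- lsubmx v).
    by rewrite -uE mulNmx; apply/esym/eqP; rewrite -addr_eq0 addrC hv.
  rewrite -mx11_scalar in hw.
  have /Fex0 [w' hw'] : (lsubmx v - w *m psi 0%N) *m a = 0.
    by rewrite mulmxBl -mulmxA hpsi0 mulmxN opprK mulmxA hw.
  exists (row_mx w' w); rewrite -[RHS]hsubmxK mul_row_block mulmx0 hw' subrK.
  by congr row_mx; rewrite -hw; apply: add0r.
move=> i v; split=> [|[w <-]]; last first.
  have FF : F i.+1 *m F i = 0.
    apply/row_matrixP => j; rewrite row_mul row0.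
    by apply/FexS; exists (row j 1%:M); rewrite -row_mul mul1mx.
  rewrite -mulmxA mulmx_block !mul0mx !mulmx0 GG hpsi !addr0 FF addNr.
  by rewrite block_mx_const mulmx0.
rewrite -{1}[v]hsubmxK mul_row_block mulmx0 add0r -row_mx0 => /eq_row_mx [hv].
move=> /Gex [w hw].
have /FexS [w' hw'] : (lsubmx v - w *m psi i.+1) *m F i = 0.
  by rewrite mulmxBl -mulmxA hpsi mulmxN opprK mulmxA hw.
exists (row_mx w' w); rewrite mul_row_block mulmx0 add0r hw' subrK hw.
exact: hsubmxK.
Qed.

(** * Monomial ideals and iterated mapping cones *)

Lemma monom_genP (s : seq 'X_{1..n}) (p : S) :
  monom_gen s p <->
  forall m, m \in msupp p -> has (fun m' => m' <= m)%MM s.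
Proof.
split=> [[k [a [g [gP ->]]]] m /msupp_sum_le /flattenP[_ /mapP[i _ ->]]|hp].
  have [m' m's ->] := gP i; move/msuppM_le/allpairsP=> [[m1 m2] /= [_]].
  rewrite msuppX inE => /eqP-> ->; apply/hasP; exists m' => //.
  exact: lem_addl.
(* The first generator that divides [m]; the default is not reached on the support of [p]. *)
pose div m := nth 0%MM s (find (fun m' => m' <= m)%MM s).
have divP m : m \in msupp p -> div m \in s /\ (div m <= m)%MM.
  by move=> /hp hm; rewrite mem_nth -?has_find //; split=> //; apply: nth_find hm.
exists (size (msupp p)).
exists (fun i => p@_(nth 0%MM (msupp p) i)
                  *: 'X_[nth 0%MM (msupp p) i - div (nth 0%MM (msupp p) i)]).
exists (fun i => 'X_[div (nth 0%MM (msupp p) i)]).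
split=> [i|].
  by exists (div (nth 0%MM (msupp p) i)) => //; apply divP; rewrite mem_nth.
rewrite {1}[p]mpolyE (big_nth 0%MM) big_mkord; apply: eq_bigr => i _.
by rewrite -scalerAl -mpolyXD submK //; apply divP; rewrite mem_nth.
Qed.

Lemma monom_genMX (s : seq 'X_{1..n}) (m : 'X_{1..n}) (p : S) :
  monom_gen s (p * 'X_[m]) <->
  forall m0, m0 \in msupp p -> has (fun m' => m' <= m0 + m)%MM s.
Proof.
rewrite monom_genP; split=> h m0.
  move=> m0p; apply: h; rewrite (perm_mem (msuppMX _ _)) addmC.
  by apply/mapP; exists m0.
by rewrite (perm_mem (msuppMX _ _)) => /mapP[m1 /h m1p ->]; rewrite addmC.
Qed.

(** The monomials of [p] divisible by a member of [s] make up [f]; each of the others is divisible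
    by [m] and contributes its quotient to [g]. *)
Lemma monom_gen_rcons (s : seq 'X_{1..n}) m (p : S) : monom_gen (rcons s m) p <->
  exists f g, monom_gen s f /\ p = f + g * 'X_[m].
Proof.
split=> [/monom_genP hp|[f [g [/monom_genP hf ->]]]]; last first.
  apply/monom_genP => m0 /msuppD_le; rewrite mem_cat has_rcons.
  case/orP=> [/hf ->|]; first exact: orbT.
  move=> /msuppM_le/allpairsP[[m1 m2] /= [_]].
  by rewrite msuppX inE => /eqP-> ->; rewrite lem_addl.
pose P m0 := has (fun m' => m' <= m0)%MM s.
exists (\sum_(m0 <- msupp p | P m0) p@_m0 *: 'X_[m0]).
exists (\sum_(m0 <- msupp p | ~~ P m0) p@_m0 *: 'X_[m0 - m]); split.
  apply/monom_genP => m0 /msupp_sum_le/flattenP[ms /mapP[m1]].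
  rewrite mem_filter => /andP[Pm1 _] -> /msuppZ_le.
  by rewrite msuppX inE => /eqP ->.
rewrite {1}[p]mpolyE (bigID P) /=; congr (_ + _).
rewrite big_seq_cond [in RHS]big_seq_cond mulr_suml.
apply: eq_bigr => m0 /andP[/hp].
rewrite has_rcons /P => /orP[hm _|-> //].
by rewrite -scalerAl -mpolyXD submK.
Qed.

Lemma lin_res_monom_gen d (s : seq 'X_{1..n}) :
  (forall m, m \in s -> mdeg m = d) ->
  (forall i, (i < size s)%N ->
     lin_res 1 (fun p => monom_gen (take i s) (p * 'X_[nth 0%MM s i]))) ->
  lin_res d (monom_gen s).
Proof.
elim/last_ind: s => [|s m IH] sd colons.
  apply: lin_res_ext (lin_res0 d) => p; rewrite monom_genP.
  split=> [-> m|h]; first by rewrite msupp0.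
  apply: msuppnil0; case: (msupp p) h => // m r /(_ m).
  by rewrite mem_head => /(_ isT).
apply: (@lin_res_cone d (monom_gen s) (fun p => monom_gen s (p * 'X_[m])) _ 'X_[m]).
- apply: IH => [m' m's|i lt_i]; first by apply: sd; rewrite mem_rcons inE m's orbT.
  have := colons i; rewrite size_rcons ltnW // -cats1 takel_cat ?(ltnW lt_i) //.
  by rewrite nth_cat lt_i => /(_ isT).
- have := colons (size s); rewrite size_rcons ltnSn => /(_ isT).
  by rewrite -cats1 take_size_cat // nth_cat ltnn subnn.
- by rewrite dhomogX; apply/eqP/sd; rewrite mem_rcons mem_head.
- by [].
- by move=> p; apply: monom_gen_rcons.
Qed.

(** A new variable is a nonzerodivisor modulo the ideal of the previous ones, so the colon is that
    ideal itself and one resolution serves both arguments of the cone. *)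
Lemma lin_res_vars (A : seq 'I_n) :
  uniq A -> lin_res 1 (monom_gen [seq U_(x)%MM | x <- A]).
Proof.
elim/last_ind: A => [|A x IH]; rewrite ?rcons_uniq.
  by move=> _; apply: lin_res_monom_gen.
move=> /andP[xA /IH resA]; rewrite map_rcons.
apply: (lin_res_cone resA resA) (monom_gen_rcons _ _).
  by rewrite dhomogX /= mdeg1.
move=> p; rewrite monom_genMX monom_genP.
split=> h m /h /hasP[_ /mapP[y yA ->] /mnm_lepP le_y].
  apply/hasP; exists U_(y)%MM; first exact: map_f.
  by apply/mnm_lepP => k; rewrite mnmDE (leq_trans (le_y k)) ?leq_addr.
apply/hasP; exists U_(y)%MM; first exact: map_f.
apply/mnm_lepP => k; have := le_y k; rewrite mnmDE !mnm1E.
case: (y =P k) => // <-; case: (x =P y) => [xy|_]; last by rewrite addn0.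
by rewrite xy yA in xA.
Qed.

Lemma lin_res_has_linear_resolution t I :
  lin_res t I -> has_linear_resolution t I.
Proof.
move=> [r [D [a [homD homa surj ex0 exS]]]]; split.
  move=> p; split=> [/surj [v hv]|[k [c [g [gP ->]]]]].
    exists (r 0%N), (v 0), (fun j => a j 0); split=> [j|]; last first.
      by have /(congr1 (fun A : 'M[S]_1 => A 0 0)) := hv; rewrite !mxE eqxx.
    split; last exact: homa.
    apply/surj; exists (delta_mx 0 j); rewrite -rowE.
    by rewrite [LHS]mx11_scalar mxE.
  have [v hv] := fin_all_exists (fun i => (surj (g i)).1 (gP i).1).
  apply/surj; exists (\sum_i c i *: v i); rewrite mulmx_suml raddf_sum /=.
  by apply: eq_bigr => i _; rewrite -scalemxAl hv scale_scalar_mx.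
(* With every shift in step [i] equal to [i + t], minimality holds because linear entries have no
   constant term. *)
pose deg i (k : 'I_(r i)) := (i + t)%N.
have hD i k l m : m \in msupp (D i k l) -> (mdeg m + deg _ l = deg _ k)%N.
  by rewrite /deg addSn => mD; rewrite (dhomog_mf (homD i k l) mD).
have ha k m : m \in msupp (a k 0) -> mdeg m = deg _ k.
  by move=> ma; rewrite (dhomog_mf (homa k 0) ma).
have hs p : I p <-> exists v : 'rV[S]_(r 0), (v *m a) 0 0 = p.
  rewrite surj; split=> [] [v hv]; exists v; first by rewrite hv mxE eqxx.
  by rewrite -hv -mx11_scalar.
have hm i k l : (D i k l)@_0%MM = 0.
  by apply: (dhomog_nemf_coeff (homD i k l)); rewrite /= mdeg0.
exists (MinFreeRes hD ha hs ex0 exS hm) => i j ij.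
by apply/eqP; rewrite cards_eq0; apply/eqP/setP=> k; rewrite !inE; apply/eqP=> /esym.
Qed.

End LinearResolutions.

Lemma ideal_gen_ext (R : comNzRingType) (X Y : R -> Prop) :
  (forall p, X p <-> Y p) -> ideal_eq (ideal_gen X) (ideal_gen Y).
Proof.
by move=> eqXY p; split=> -[k [a [g [gP ->]]]]; exists k, a, g; split=> // i;
  apply/eqXY.
Qed.

(** * From exchange sequences to linear quotients and linear resolutions *)

Section SquarefreeLinearQuotients.
Local Open Scope ring_scope.
Variables (K : fieldType) (T : finType).
Local Notation n := #|T|.
Local Notation S := {mpoly K[n]}.

Lemma exchange_seq_linear (I : S -> Prop) (s : seq {set T}) t :
  ideal_eq I (monom_gen (map (@set_monom T) s)) ->
  uniq s -> (forall A, A \in s -> #|A| = t) -> exchange_seq s ->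
  has_linear_quotients I /\ has_linear_resolution t I.
Proof.
move=> defI us card_s xs; set ms := map _ s in defI *.
have deg_ms m : m \in ms -> mdeg m = t.
  by move=> /mapP[A As ->]; rewrite mdeg_set_monom card_s.
have size_ms : size ms = size s by rewrite size_map.
have colonP i : (i < size s)%N -> exists A : {set 'I_n}, forall p : S,
    monom_gen (take i ms) (p * 'X_[nth 0%MM ms i]) <->
    monom_gen [seq U_(x)%MM | x <- enum A] p.
  move=> lt_i; have [A hA] := set_monom_colon xs lt_i; exists A => p.
  rewrite monom_genMX monom_genP.
  by split=> h m /h; rewrite hA.
split; last first.
  apply: lin_res_has_linear_resolution; apply: (@lin_res_ext _ _ _ (monom_gen ms)).
    by move=> p; rewrite defI.
  apply: lin_res_monom_gen => // i; rewrite size_ms => /colonP[A hA].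
  by apply: lin_res_ext (lin_res_vars K (enum_uniq A)) => p; rewrite hA.
exists ms.
  split=> [||s' sub eqI]; first by rewrite map_inj_uniq //; apply: set_monom_inj.
    by [].
  move=> m mms; have : I 'X_[m].
    apply/defI/monom_genP => m0; rewrite msuppX inE => /eqP->.
    by apply/hasP; exists m; rewrite ?lepm_refl.
  move/eqI/monom_genP/(_ m); rewrite msuppX mem_head => /(_ isT)/hasP[m' m's' le_m].
  suff -> : m = m' by [].
  (* [m'] divides [m] and both have degree [t], so the quotient has degree 0. *)
  rewrite -(submK le_m); apply/eqP; rewrite -[X in _ == X]add0m eqm_add2r -mdeg_eq0.
  by rewrite -(eqn_add2r (mdeg m')) -mdegD submK // !deg_ms // sub.
move=> i; rewrite size_ms => /andP[_ /colonP[A hA]]; exists A => p.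
have -> : ideal_gen (fun q : S => exists2 x, x \in A & q = 'X_x) p <->
          monom_gen [seq U_(x)%MM | x <- enum A] p.
  apply: ideal_gen_ext => q; split=> [[x xA ->]|[m /mapP[x xA ->] ->]].
    by exists U_(x)%MM => //; apply: map_f; rewrite mem_enum.
  by exists x => //; rewrite -mem_enum.
rewrite -hA; split=> [h|/monom_genMX h q].
  apply: h; exists 1%N, (fun=> 1), (fun=> 'X_[nth 0%MM ms i]).
  split=> [_|]; last by rewrite big_ord1 mul1r.
  by exists (nth 0%MM ms i); rewrite ?mem_head.
move=> /monom_genP hq; apply/monom_genP => m /msuppM_le/allpairsP[[m1 m2] /= [m1p]].
move=> /hq; rewrite has_seq1 => le_m ->.
apply/hasP; have /hasP[m' m's le_m'] := h _ m1p; exists m' => //.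
apply: lepm_trans le_m' _; apply/mnm_lepP => l.
by rewrite !mnmDE leq_add2l; apply/mnm_lepP.
Qed.

End SquarefreeLinearQuotients.

(** * Path ideals *)

Lemma prod_set_monom (K : fieldType) (T : finType) (s : seq T) : uniq s ->
  (\prod_(v <- s) 'X_(enum_rank v) = 'X_[set_monom [set x in s]] :> {mpoly K[#|T|]})%R.
Proof.
move=> us; rewrite -(big_map (fun v => U_(enum_rank v)%MM) predT (fun m => 'X_[m])%R).
rewrite mpolyX_prod big_map; congr 'X_[_]%R.
apply/mnmP => i; rewrite mnm_sumE mnmE inE.
under eq_bigr => v _ do rewrite mnm1E (can2_eq enum_rankK enum_valK).
rewrite -(count_uniq_mem _ us) -sum1_count [RHS]big_mkcond.
by apply: eq_bigr => v _ /=; case: eqP.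
Qed.

Theorem corollary6p3 (K : fieldType) (G : sgraph)
    (hgap : gap_free G) (hclaw : claw_free G)
    (t : nat) (ht : t \in [:: 3; 4; 5]) :
  has_linear_quotients (@path_ideal K t G) /\
  has_linear_resolution t (@path_ideal K t G).
Proof.
have [r /exchange_order_seq[s [us sF xs]]] := path_sets_exchange_order hgap hclaw ht.
apply: (exchange_seq_linear _ us _ xs) => [|A]; last by rewrite sF => /card_path_sets.
(* Paths with the same vertex set give the same monomial, so the generators correspond to
   [path_sets]. *)
apply: ideal_gen_ext => p; split=> [[s' [us' ps' ->]]|[m /mapP[A]]].
  rewrite prod_set_monom //; eexists => //; apply: map_f.
  by rewrite sF; apply/path_setsP; exists s'; rewrite size_tuple.
rewrite sF => /path_setsP[s' [us' ps' st ->]] -> ->.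
by exists (Tuple (introT eqP st)); rewrite prod_set_monom.
Qed.
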